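(* For every integer $n\ge 1$, the first and last unique coefficients of row $n$ for $l=3$ are $$g_3(n,1)=g_3(n,n)=\frac{n(n+1)}{2}.$$
   Context: For positive integers $l\ge 2$ and $n$, consider the expansion of $(x^{n-1}+x^{n-2}+\cdots+x+1)^l$, whose list of coefficients (of $x^0,x^1,\dots,x^{l(n-1)}$) is called a coefficient pattern. The unique coefficient pattern of row $n$ for the power $l$, denoted $U_n(l)$, consists of the coefficients of this pattern that are not already present in the patterns of the preceding (smaller) $n$. The comparison is made by position from either end of the list: the coefficients of $x^j$ with $j\le n-2$, and symmetrically those with $j\ge (l-1)(n-1)+1$, are the ones already present. So $U_n(l)$ is the ordered list of the coefficients of $x^j$ in $(x^{n-1}+\cdots+1)^l$ for $j=n-1,n,\dots,(l-1)(n-1)$. The $k$-th entry of this list, i.e. the coefficient of $x^{n+k-2}$ in $(x^{n-1}+\cdots+1)^l$, is denoted $g_l(n,k)$. For $l=3$ the list $U_n(3)$ has $n$ entries, $k=1,\dots,n$: $U_1(3)=(1)$, $U_2(3)=(3,3)$, $U_3(3)=(6,7,6)$, $U_4(3)=(10,12,12,10)$. *)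

(* Defs.v *)
From mathcomp Require Import all_boot all_order all_algebra.

Set Implicit Arguments.
Unset Strict Implicit.
Unset Printing Implicit Defensive.

Import GRing.Theory.
Local Open Scope ring_scope.

(* Coefficients of (x^(n-1) + ... + x + 1)^l, constant coefficient first. *)
Definition coef_pattern (l n : nat) : seq nat :=
  ((\sum_(i < n) 'X^i) ^+ l : {poly nat}).

(* U_n(l): the entries at positions j = n-1, ..., (l-1)(n-1), for n >= 1. *)
Definition unique_pattern (l n : nat) : seq nat :=
  [seq nth 0%N (coef_pattern l n) j | j <- index_iota n.-1 (l.-1 * n.-1).+1].

(* g_l(n,k): entries are numbered from k = 1. *)
Definition g (l n k : nat) : nat := nth 0%N (unique_pattern l n) k.-1.

(* Main.v *)
(** With [P = 1 + X + ... + X^m] and [n = m + 1], the coefficient of [X^k] in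
    [P * q] is a sum of [n] consecutive coefficients of [q].  At both ends of
    the middle window of [P^3] (exponents [m] and [2m]) this is the sum of the
    coefficients [1, 2, ..., n] of one flank of the triangular pattern [P^2]. *)
Require Import Defs.
From mathcomp Require Import all_boot all_order all_algebra.
From mathcomp Require Import zify ring.

Local Open Scope ring_scope.

Import GRing.Theory.

Lemma coef_geomM (n k : nat) (q : {poly nat}) :
  ((\sum_(i < n) 'X^i) * q)`_k =
  (\sum_(i < n) (if k < i then 0 else (q`_(k - i))%R))%N.
Proof.
rewrite mulr_suml coef_sum.
by apply: eq_bigr => i _; rewrite coefXnM.
Qed.

Lemma coef_geom (n k : nat) : (\sum_(i < n) 'X^i : {poly nat})`_k = (k < n)%N.
Proof.
under eq_bigr do rewrite -['X^_]scale1r.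
by rewrite -(poly_def n (fun=> 1)) coef_poly; case: (k < n)%N.
Qed.

Lemma sum_ord_leq (n j : nat) : (\sum_(i < n) (i <= j) = minn n j.+1)%N.
Proof. by elim: n => [|n IHn]; rewrite ?big_ord0 ?big_ord_recr /= ?IHn; lia. Qed.

Lemma sum_ord_geq (n j : nat) : (\sum_(i < n) (j <= i) = n - j)%N.
Proof. by elim: n => [|n IHn]; rewrite ?big_ord0 ?big_ord_recr /= ?IHn; lia. Qed.

(** Rising flank: in [j = i + (j - i)] the second part never exceeds [m], so only [i <= j] restricts
    [i]. *)
Lemma coef_geom_sqr_low (m j : nat) : (j <= m)%N ->
  ((\sum_(i < m.+1) 'X^i : {poly nat}) ^+ 2)`_j = j.+1.
Proof.
move=> jm; rewrite expr2 coef_geomM -[RHS](_ : minn m.+1 j.+1 = _); last lia.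
rewrite -sum_ord_leq; apply: eq_bigr => i _; rewrite coef_geom.
by case: ltnP => ij; lia.
Qed.

(** Falling flank: the cofactor exponent [m.*2 - j - i] is at most [m] exactly when [m - j <= i]. *)
Lemma coef_geom_sqr_high (m j : nat) : (j <= m)%N ->
  ((\sum_(i < m.+1) 'X^i : {poly nat}) ^+ 2)`_(m.*2 - j) = j.+1.
Proof.
move=> jm; rewrite expr2 coef_geomM.
rewrite -[RHS](_ : m.+1 - (m - j) = _)%N; last lia.
rewrite -(sum_ord_geq m.+1 (m - j)); apply: eq_bigr => i _; rewrite coef_geom.
by have im := ltn_ord i; case: ltnP => ?; [lia | case: ltnP => ?; case: leqP; lia].
Qed.

Lemma coef_geom_cube_low (m : nat) :
  ((\sum_(i < m.+1) 'X^i : {poly nat}) ^+ 3)`_m = (\sum_(i < m.+1) i.+1)%N.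
Proof.
(* The sum meets the coefficients of the square from exponent [m] down to [0]; reversing it makes
   the [i]-th term [i.+1]. *)
rewrite exprS coef_geomM (reindex_inj rev_ord_inj); apply: eq_bigr => i _ /=.
have im := ltn_ord i; rewrite ifF; last lia.
by rewrite coef_geom_sqr_low; lia.
Qed.

Lemma coef_geom_cube_high (m : nat) :
  ((\sum_(i < m.+1) 'X^i : {poly nat}) ^+ 3)`_m.*2 = (\sum_(i < m.+1) i.+1)%N.
Proof.
rewrite exprS coef_geomM; apply: eq_bigr => i _.
have im := ltn_ord i; rewrite ifF; last lia.
by rewrite coef_geom_sqr_high; lia.
Qed.

Lemma sum_ord_succ (n : nat) : (2 * \sum_(i < n) i.+1 = n * n.+1)%N.
Proof. by elim: n => [|n IHn]; rewrite ?big_ord0 // big_ord_recr /= mulnDr IHn; lia. Qed.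

(** The upper bound keeps the entry inside the window, where [nth] does not fall back on its default
    [0]. *)
Lemma g_coef (l n k : nat) : (0 < k)%N -> (n.-1 + k.-1 <= l.-1 * n.-1)%N ->
  g l n k = ((\sum_(i < n) 'X^i : {poly nat}) ^+ l)`_(n.-1 + k.-1).
Proof.
move=> k_gt0 kl; rewrite /g /unique_pattern (nth_map 0%N) ?size_iota; last lia.
by rewrite nth_iota //; lia.
Qed.

Theorem proposition2p2 (n : nat) (hn : (1 <= n)%N) :
  g 3 n 1 = g 3 n n /\
  (g 3 n n)%:R = n%:R * (n%:R + 1) / 2%:R :> rat.
Proof.
case: n hn => // m _.
have g1 : g 3 m.+1 1 = (\sum_(i < m.+1) i.+1)%N.
  by rewrite g_coef /= ?addn0 ?coef_geom_cube_low //; lia.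
have gn : g 3 m.+1 m.+1 = (\sum_(i < m.+1) i.+1)%N.
  by rewrite g_coef /= ?addnn ?coef_geom_cube_high //; lia.
split; first by rewrite g1 gn.
(* The doubled identity in [nat] is cast to [rat], where dividing by 2 is exact. *)
have /(congr1 (fun k => k%:R : rat)) := sum_ord_succ m.+1.
by rewrite -gn !natrM -[m.+2%:R]natr1 => <-; field.
Qed.
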